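(* For every $n\ge0$, with $Y:={}_2F_1\!\left(1,n+\tfrac12;n+1;-1\right)$ and $t(n):=2\sqrt2\,\alpha_n$, the coefficient $\delta_3$ of $q^3$ in the expansion $-i\,d_n=\sum_j\delta_jq^j$ is $$\delta_3=-\tfrac{1}{16}(16n^2+8n+3)\,t(n)^3Y^2+\tfrac14(4n^2+11n+3)\,t(n)^3Y-\Big(4n^4+4n^3+\tfrac{23n^2}{4}+\tfrac{7n}{2}+\tfrac34\Big)t(n)^3+\Big(32n^4+32n^3+48n^2+20n+\tfrac{27}{8}\Big)t(n).$$
   Context: For integers $k\ge0$ put $\alpha_k:=(-4)^{-k}\binom{2k}{k}$. Put $c_0(2k):=(-1)^k\frac{d^{2k}}{dx^{2k}}\big(e^{x}+e^{-x}\big)^{-1/2}\big|_{x=0}$ and $c_0(2k+1):=0$. As power series in $q$ define $c(2k)(q):=c_0(2k)+2(-1)^k\sum_{\ell\ge0}\alpha_\ell(\tfrac12+2\ell)^{2k}\frac{q^{2\ell+1}}{1-q^{2\ell+1}}$ and $c(2k+1)(q):=0$. For $n\ge0$ let $D_n(q)$ be the determinant of the Hankel matrix $(c(i+j)(q))_{0\le i,j\le n}$, and $D_{-1}:=1$. The Jacobi coefficients are $a(n)^2(q):=D_{n-1}(q)D_{n+1}(q)/D_n(q)^2$ for $n\ge0$, with $a(-1)^2:=0$, and $d_n$ is defined by $-i\,d_n:=-2n-\tfrac12+a(n)^2-a(n-1)^2$. ${}_2F_1$ is the Gauss hypergeometric function. *)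

(* Defs.v *)
From HB Require Import structures.
From mathcomp Require Import all_boot all_order all_algebra.
From mathcomp Require Import all_classical all_reals all_analysis.

Set Implicit Arguments.
Unset Strict Implicit.
Unset Printing Implicit Defensive.

Import Order.TTheory GRing.Theory Num.Theory.
Import numFieldNormedType.Exports.

Local Open Scope ring_scope.

(* Formal power series over a field, as sequences of coefficients.  They are
   wrapped in a record because [nat -> R] already carries the pointwise ring
   structure. *)
Record fps (R : Type) : Type := Fps { fcoef : nat -> R }.

HB.instance Definition _ (R : Type) := gen_eqMixin (fps R).
HB.instance Definition _ (R : Type) := gen_choiceMixin (fps R).

Lemma fpsP (R : Type) (f g : fps R) :
  (forall n, fcoef f n = fcoef g n) -> f = g.
Proof. by case: f g => f [g] /= fg; congr Fps; apply/funext. Qed.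

Definition fpsC (R : fieldType) (a : R) : fps R :=
  Fps (fun n => if n == 0%N then a else 0).

Definition fpsX (R : fieldType) : fps R := Fps (fun n => (n == 1%N)%:R).

Section FpsRing.
Variable R : fieldType.
Implicit Types f g h : fps R.

Definition fps_add f g : fps R := Fps (fun n => fcoef f n + fcoef g n).
Definition fps_opp f : fps R := Fps (fun n => - fcoef f n).

Fact fps_addA : associative fps_add.
Proof. by move=> f g h; apply: fpsP => n /=; rewrite addrA. Qed.
Fact fps_addC : commutative fps_add.
Proof. by move=> f g; apply: fpsP => n /=; rewrite addrC. Qed.
Fact fps_add0 : left_id (fpsC 0) fps_add.
Proof. by move=> f; apply: fpsP => n /=; rewrite if_same add0r. Qed.
Fact fps_addN : left_inverse (fpsC 0) fps_opp fps_add.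
Proof. by move=> f; apply: fpsP => n /=; rewrite if_same addNr. Qed.

HB.instance Definition _ :=
  GRing.isZmodule.Build (fps R) fps_addA fps_addC fps_add0 fps_addN.

Definition fps_mul f g : fps R :=
  Fps (fun n => \sum_(i < n.+1) fcoef f i * fcoef g (n - i)%N).

Definition fps_trunc m f : {poly R} := \poly_(i < m) fcoef f i.

Fact coef_fps_mul f g m n : (n < m)%N ->
  fcoef (fps_mul f g) n = (fps_trunc m f * fps_trunc m g)`_n.
Proof.
move=> nm; rewrite coefM; apply: eq_bigr => i _.
have im : (i < m)%N := leq_ltn_trans (leq_ord i) nm.
have nim : (n - i < m)%N := leq_ltn_trans (leq_subr i n) nm.
by rewrite /fps_trunc !coef_poly im nim.
Qed.

Fact fps_mulA : associative fps_mul.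
Proof.
move=> f g h; apply: fpsP => n; pose t := fps_trunc n.+1.
have tE e i : (i < n.+1)%N -> fcoef e i = (t e)`_i.
  by move=> lt_i; rewrite coef_poly lt_i.
transitivity ((t f * t g * t h)`_n).
  rewrite -mulrA coefM; apply: eq_bigr => i _.
  by rewrite (@coef_fps_mul _ _ n.+1) ?ltnS ?leq_subr // tE.
rewrite coefM; apply: eq_bigr => i _.
by rewrite (@coef_fps_mul _ _ n.+1) // (tE h) // ltnS leq_subr.
Qed.

Fact fps_mulC : commutative fps_mul.
Proof.
by move=> f g; apply: fpsP => n; rewrite !(@coef_fps_mul _ _ n.+1) // mulrC.
Qed.

Fact fps_mul1 : left_id (fpsC 1) fps_mul.
Proof.
move=> f; apply: fpsP => n /=; rewrite big_ord_recl /= mul1r subn0.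
by rewrite big1 ?addr0 // => i _; rewrite mul0r.
Qed.

Fact fps_mulDl : left_distributive fps_mul (@GRing.add (fps R)).
Proof.
move=> f g h; apply: fpsP => n /=; rewrite -big_split /=.
by apply: eq_bigr => i _; rewrite mulrDl.
Qed.

Fact fps_1neq0 : fpsC 1 != 0 :> fps R.
Proof.
apply/eqP => /(congr1 (fun f => fcoef f 0)) /= /eqP.
by rewrite oner_eq0.
Qed.

HB.instance Definition _ := GRing.Zmodule_isComNzRing.Build (fps R)
  fps_mulA fps_mulC fps_mul1 fps_mulDl fps_1neq0.

Definition fps_unit : pred (fps R) := fun f => fcoef f 0 != 0.

(* The coefficients of 1/f, from g_0 = 1/f_0 and
   f_0 g_n = - (f_1 g_(n-1) + ... + f_n g_0);
   [fps_inv_seq f n] lists g_0, ..., g_(n-1). *)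
Fixpoint fps_inv_seq f (n : nat) : seq R :=
  if n is m.+1 then
    let s := fps_inv_seq f m in
    rcons s ((fcoef f 0)^-1 *
      ((m == 0%N)%:R - \sum_(i < m) fcoef f i.+1 * s`_(m - i.+1)))
  else [::].

Definition fps_inv f : fps R :=
  if fps_unit f then Fps (fun n => (fps_inv_seq f n.+1)`_n) else f.

Fact size_fps_inv_seq f n : size (fps_inv_seq f n) = n.
Proof. by elim: n => //= n IHn; rewrite size_rcons IHn. Qed.

Fact nth_fps_inv_seq f n i : (i < n)%N ->
  (fps_inv_seq f n)`_i = (fps_inv_seq f i.+1)`_i.
Proof.
elim: n => // n IHn; rewrite ltnS leq_eqVlt => /predU1P[-> //|lt_in].
by rewrite [in LHS]/= nth_rcons size_fps_inv_seq lt_in IHn.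
Qed.

Fact fps_inv_seqE f n : (fps_inv_seq f n.+1)`_n =
  (fcoef f 0)^-1 * ((n == 0%N)%:R -
    \sum_(i < n) fcoef f i.+1 * (fps_inv_seq f (n - i.+1).+1)`_(n - i.+1)).
Proof.
rewrite [fps_inv_seq f n.+1]/= nth_rcons size_fps_inv_seq ltnn eqxx.
congr (_ * (_ - _)); apply: eq_bigr => i _.
by rewrite nth_fps_inv_seq // ltn_subrL (leq_ltn_trans _ (ltn_ord i)).
Qed.

Fact fps_mulVf : {in fps_unit, left_inverse 1 fps_inv *%R}.
Proof.
move=> f uf; rewrite mulrC; apply: fpsP => n.
have f0 : fcoef f 0 != 0 := uf.
have -> : fps_inv f = Fps (fun n => (fps_inv_seq f n.+1)`_n).
  by rewrite /fps_inv ifT.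
transitivity (\sum_(i < n.+1)
    fcoef f i * (fps_inv_seq f (n - i).+1)`_(n - i)) => //.
by rewrite big_ord_recl subn0 fps_inv_seqE mulVKf // subrK; case: n.
Qed.

Fact fps_unitPl f g : g * f = 1 -> fps_unit f.
Proof.
move=> /(congr1 (fun h => fcoef h 0)) /=; rewrite big_ord1 /= => gf.
by apply/eqP => f0; move/eqP: gf; rewrite f0 mulr0 eq_sym oner_eq0.
Qed.

Fact fps_inv_out : {in [predC fps_unit], fps_inv =1 id}.
Proof. by move=> f nuf; rewrite /fps_inv ifN. Qed.

HB.instance Definition _ := GRing.ComNzRing_hasMulInverse.Build (fps R)
  fps_mulVf fps_unitPl fps_inv_out.

End FpsRing.

Section Defs.
Variable R : realType.

(* Coefficientwise sum of a sequence of power series; below, the partial sums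
   of each coefficient are eventually constant. *)
Definition fps_sum (F : nat -> fps R) : fps R :=
  Fps (fun m => limn (series (fun l => fcoef (F l) m))).

Definition alpha (k : nat) : R := (- 4) ^- k * 'C(k.*2, k)%:R.

Definition c0 (m : nat) : R :=
  if odd m then 0
  else (-1) ^+ m./2 *
       derive1n m (fun x : R => (expR x + expR (- x)) `^ (- 2^-1)) 0.

Definition lambert (s : nat) : fps R := fpsX R ^+ s / (1 - fpsX R ^+ s).

Definition c (m : nat) : fps R :=
  if odd m then 0
  else fpsC (c0 m) +
       fpsC (2 * (-1) ^+ m./2) *
       fps_sum (fun l =>
         fpsC (alpha l * (2^-1 + 2 * l%:R) ^+ m) * lambert l.*2.+1).

Definition D (n : int) : fps R :=
  if n is Posz m then \det (\matrix_(i < m.+1, j < m.+1) c (i + j)%N) else 1.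

(* The squared Jacobi coefficient a(n)^2; the quotient is a genuine one as
   soon as the constant coefficient of D n is nonzero. *)
Definition asq (n : int) : fps R :=
  if n is Posz _ then D (n - 1) * D (n + 1) / D n ^+ 2 else 0.

(* The series -i d_n, which has real coefficients. *)
Definition minus_i_d (n : nat) : fps R :=
  fpsC (- (2 * n%:R) - 2^-1) + asq n%:Z - asq (n%:Z - 1).

Definition pochhammer (a : R) (k : nat) : R := \prod_(i < k) (a + i%:R).

(* The Gauss series.  At z = -1 it converges, possibly only conditionally, if
   c > a + b - 1, and then, by Abel's theorem, its sum is the value of the
   analytic continuation. *)
Definition hyp2F1 (a b c z : R) : R :=
  limn (series (fun k =>
    pochhammer a k * pochhammer b k / (pochhammer c k * k`!%:R) * z ^+ k)).

End Defs.

(* Main.v *)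
(* In the variable s = -i y the moment functional at q = 0 has as moments the
   derivatives at 0 of g = (2 cosh)^(-1/2).  As g' = -(1/2) tanh g, the m-th
   derivative of g is Q_m(tanh) g with Q_m = A^m 1 and
   A Q = (1 - T^2) Q' - T Q / 2.  The operator A is tridiagonal on the powers
   of T, so the polynomials e_n with e_n(A) 1 = T^n satisfy
   s e_n = n e_(n-1) - (n + 1/2) e_(n+1); they are orthogonal, of squared norm
   1/(sqrt 2 alpha_n), and e_n(-1/2) = 1, e_n(-5/2) = 4 n + 1.

   The powers of q add point masses at s = +-(1/2 + 2 l), and only l = 0, 1
   matter modulo q^4.  The Gram matrix of the e_n is thus a diagonal matrix
   plus a matrix of rank 4 which splits by parity, and the matrix determinant
   lemma gives D_n modulo q^4 as a constant times two factors, one for each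
   parity b, of the form 1 + a_b w_0 + g_b w_1 with w_l = q^(2l+1)/(1-q^(2l+1))
   and a_b = 2 sqrt 2 sum_(j <= n, j = b mod 2) alpha_j.

   The sum of the two a_b is a partial sum of the binomial series
   sum_j alpha_j = 1/sqrt 2, whose tail is alpha_n Y, and their difference
   telescopes to a multiple of t(n); the rest is algebra. *)
From HB Require Import structures.
Require Import Defs.
From mathcomp Require Import all_boot all_order all_algebra.
From mathcomp Require Import all_classical all_reals all_analysis.
From mathcomp Require Import ring lra zify.

Set Implicit Arguments.
Unset Strict Implicit.
Unset Printing Implicit Defensive.

Import Order.TTheory GRing.Theory Num.Theory.
Import numFieldNormedType.Exports.

Local Open Scope ring_scope.

(** * Orthogonal polynomials at q = 0 *)

Section MeixnerPollaczek.
Variable R : realType.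
Implicit Types p q Q : {poly R}.

Lemma alpha0 : alpha R 0 = 1.
Proof. by rewrite /alpha expr0 invr1 bin0 mulr1. Qed.

Lemma alphaS k : (k%:R + 1) * alpha R k.+1 = - (k%:R + 2^-1) * alpha R k.
Proof.
have bin_doubleS : (k.+1 * 'C(k.+1.*2, k.+1) = 2 * (k.*2.+1 * 'C(k.*2, k)))%N.
  have := mul_bin_diag k.+1.*2 k; have := mul_bin_down k.*2.+1 k.
  have -> : (k.*2.+1 - k = k.+1)%N by lia.
  by rewrite doubleS /= => -> <-; rewrite -doubleS -mul2n; lia.
rewrite /alpha exprS invfM.
move/(congr1 (fun i : nat => i%:R : R)): bin_doubleS.
rewrite !natrM -natr1 -[k.*2.+1%:R]natr1 -[in k.*2%:R]muln2 natrM => bin_doubleS.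
transitivity ((-4)^-1 * (-4) ^- k * ((k%:R + 1) * ('C(k.+1.*2, k.+1))%:R) : R).
  by ring.
rewrite bin_doubleS; field.
by rewrite expf_neq0 //; lra.
Qed.

Lemma alphaSE k : alpha R k.+1 = - (k%:R + 2^-1) / (k%:R + 1) * alpha R k.
Proof.
have k1 : (k%:R + 1 : R) != 0 by rewrite natr1 pnatr_eq0.
by apply: (mulfI k1); rewrite alphaS; field.
Qed.

Lemma alpha_neq0 k : alpha R k != 0.
Proof.
by rewrite mulf_neq0 ?invr_neq0 ?expf_neq0 ?pnatr_eq0 -?lt0n ?bin_gt0 -?addnn ?leq_addr.
Qed.

(* If g' = - (1/2) T g and T' = 1 - T^2 then (Q(T) g)' = (jacobi_op Q)(T) g. *)
Definition jacobi_op Q : {poly R} :=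
  (1 - 'X^2) * Q^`() - 2^-1 *: ('X * Q).

Lemma jacobi_op_lin a p q :
  jacobi_op (a *: p + q) = a *: jacobi_op p + jacobi_op q.
Proof. by rewrite /jacobi_op derivD derivZ -!mul_polyC; ring. Qed.

(** Tridiagonality on the powers of ['X], the source of the three-term recurrence below. At [i = 0]
    the truncated predecessor is harmless, as ['X * Q] has no constant term. *)
Lemma coef_jacobi_op Q i :
  (jacobi_op Q)`_i = Q`_i.+1 *+ i.+1 - (i.-1%:R + 2^-1) * ('X * Q)`_i.
Proof.
rewrite /jacobi_op mulrBl mul1r !coefB coefZ mulrC coefMXn coef_deriv.
case: i => [|[|i]] /=; rewrite !coefXM /= ?coef_deriv.
- by rewrite !mulr0 !subr0.
- by rewrite subr0 add0r.
by rewrite subSS subn1 /= -mulr_natr; ring.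
Qed.

(** This is p(A) 1 for A = [jacobi_op]. Its constant coefficient is, up to the factor 1/sqrt 2, the
    moment functional at q = 0, because tanh vanishes at 0. *)
Definition jacobi_eval p : {poly R} :=
  \sum_(i < size p) p`_i *: iter i jacobi_op 1.

Lemma jacobi_evalE N p : (size p <= N)%N ->
  jacobi_eval p = \sum_(i < N) p`_i *: iter i jacobi_op 1.
Proof.
move=> pN; rewrite /jacobi_eval (big_ord_widen _ (fun i => p`_i *: iter i jacobi_op 1) pN).
rewrite big_mkcond; apply: eq_bigr => i _; case: ltnP => // pi.
by rewrite nth_default // scale0r.
Qed.

Lemma jacobi_eval_lin a p q :
  jacobi_eval (a *: p + q) = a *: jacobi_eval p + jacobi_eval q.
Proof.
pose N := maxn (size (a *: p + q)) (maxn (size p) (size q)).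
rewrite !(@jacobi_evalE N) ?leq_max ?leqnn ?orbT // scaler_sumr -big_split.
by apply: eq_bigr => i _; rewrite coefD coefZ scalerDl scalerA.
Qed.

HB.instance Definition _ := GRing.isLinear.Build R {poly R} {poly R} _
  jacobi_op jacobi_op_lin.
HB.instance Definition _ := GRing.isLinear.Build R {poly R} {poly R} _
  jacobi_eval jacobi_eval_lin.

Lemma jacobi_evalZ a p : jacobi_eval (a *: p) = a *: jacobi_eval p.
Proof. exact: linearZ. Qed.

Lemma jacobi_evalB p q : jacobi_eval (p - q) = jacobi_eval p - jacobi_eval q.
Proof. exact: linearB. Qed.

Lemma jacobi_evalX p : jacobi_eval ('X * p) = jacobi_op (jacobi_eval p).
Proof.
rewrite (@jacobi_evalE (size p).+1) ?(leq_trans (size_polyMleq _ _)) ?size_polyX //.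
rewrite big_ord_recl coefXM scale0r add0r linear_sum.
by apply: eq_bigr => i _; rewrite coefXM linearZ.
Qed.

Lemma jacobi_evalXn n : jacobi_eval 'X^n = iter n jacobi_op 1.
Proof.
elim: n => [|n IHn]; last by rewrite exprS jacobi_evalX IHn.
by rewrite /jacobi_eval expr0 size_poly1 big_ord1 coef1 scale1r.
Qed.

(* Meixner-Pollaczek polynomials of parameter 1/4 in the variable -i y,
   normalized so that [jacobi_eval (mpoll n) = 'X^n]. *)
Fixpoint mpoll n : {poly R} :=
  match n with
  | 0 => 1
  | m.+1 => match m with
            | 0 => (- 2) *: 'X
            | k.+1 => (m%:R + 2^-1)^-1 *: (m%:R *: mpoll k - 'X * mpoll m)
            end
  end.

Lemma addr_half_neq0 n : (n%:R + 2^-1 : R) != 0.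
Proof. by rewrite gt_eqF // ltr_wpDl ?invr_gt0. Qed.

Lemma mpollSS n : (n.+1%:R + 2^-1) *: mpoll n.+2 =
  n.+1%:R *: mpoll n - 'X * mpoll n.+1.
Proof. by rewrite [mpoll n.+2]/= scalerA mulfV ?addr_half_neq0 // scale1r. Qed.

Lemma nat_ind2 (P : nat -> Prop) : P 0 -> P 1 ->
  (forall n, P n -> P n.+1 -> P n.+2) -> forall n, P n.
Proof.
move=> P0 P1 PS n; suff [] : P n /\ P n.+1 by [].
by elim: n => // n [? ?]; split; [|apply: PS].
Qed.

(** The recurrence of [mpoll] is A T^m = m T^(m-1) - (m + 1/2) T^(m+1) solved for T^(m+1). *)
Lemma jacobi_eval_mpoll n : jacobi_eval (mpoll n) = 'X^n.
Proof.
elim/nat_ind2: n => [||n IHn IHn1].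
- exact: (jacobi_evalXn 0).
- rewrite [mpoll 1]/= linearZ /= (jacobi_evalXn 1 : jacobi_eval 'X = _) /=.
  rewrite /jacobi_op derivC mulr0 add0r mulr1.
  by rewrite scalerN scalerA mulNr mulfV ?pnatr_eq0 // scaleN1r opprK.
apply: (scalerI (addr_half_neq0 n.+1)); rewrite -jacobi_evalZ mpollSS jacobi_evalB jacobi_evalZ.
rewrite jacobi_evalX IHn IHn1; apply/polyP => i.
rewrite coefB !coefZ coef_jacobi_op coefXM !coefXn.
case: i => [|i] /=.
  rewrite !eqSS; case: n {IHn IHn1} => [|n];
  by rewrite ?mulr0 ?mulr1 ?subr0 ?mulr1n ?subrr ?mul0rn ?subrr.
rewrite !eqSS; case: (eqVneq i.+1 n) => [<-|ne].
  by rewrite (ltn_eqF (ltnW (ltnSn i.+1))) !mulr0 subr0 mulr1 subrr.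
rewrite mul0rn sub0r mulr0 sub0r opprK; case: eqP => [->|_]; last by rewrite !mulr0.
by rewrite !mulr1.
Qed.

(** The induction moves the factor ['X] of the recurrence onto [q], hence the arbitrary [q]. For
    [q = mpoll j] this is orthogonality, with squared norm 1/alpha_i before the factor 1/sqrt 2. *)
Lemma jacobi_eval_orth i q :
  (jacobi_eval (mpoll i * q))`_0 = (alpha R i)^-1 * (jacobi_eval q)`_i.
Proof.
elim/nat_ind2: i q => [q|q|n IHn IHn1 q].
- by rewrite mul1r alpha0 invr1 mul1r.
- rewrite [mpoll 1]/= -scalerAl jacobi_evalZ coefZ jacobi_evalX coef_jacobi_op coefXM /= mulr0 subr0.
  have -> : alpha R 1 = - 2^-1.
    by rewrite alphaSE alpha0; field.
  by rewrite invrN invrK.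
have n1 : (n%:R + 1 : R) != 0 by rewrite natr1 pnatr_eq0.
have n2 : (n%:R + 1 + 1 : R) != 0 by rewrite !natr1 pnatr_eq0.
apply: (mulfI (addr_half_neq0 n.+1)).
rewrite -coefZ -jacobi_evalZ scalerAl mpollSS mulrBl -scalerAl.
rewrite jacobi_evalB jacobi_evalZ coefB coefZ IHn.
rewrite ['X * _]mulrC -(mulrA (mpoll n.+1)) IHn1 jacobi_evalX coef_jacobi_op coefXM /=.
have := alpha_neq0 n.
rewrite !alphaSE -mulr_natl -!natr1.
move: (alpha R n) (_`_n) (_`_n.+2) => al q0 q2 al0.
have n0 : 0 <= n%:R :> R by [].
by field; rewrite n1 n2 al0 !gt_eqF //; lra.
Qed.

Lemma size_mpoll n : (size (mpoll n) <= n.+1)%N.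
Proof.
elim/nat_ind2: n => [||n IHn IHn1].
- by rewrite size_poly1.
- by rewrite (leq_trans (size_scale_leq _ _)) ?size_polyX.
rewrite (leq_trans (size_scale_leq _ _)) // (leq_trans (size_polyD _ _)) // size_polyN.
rewrite geq_max (leq_trans (size_scale_leq _ _)) ?(leq_trans IHn) //=; last by lia.
by rewrite (leq_trans (size_polyMleq _ _)) // size_polyX.
Qed.

(** The change from monomials to the [mpoll] basis multiplies the Hankel determinant by the square
    of the product of these leading coefficients. *)
Lemma coef_mpoll n : (mpoll n)`_n = \prod_(i < n) (- (i%:R + 2^-1)^-1).
Proof.
case: n => [|n]; first by rewrite coef1 big_ord0.
elim: n => [|n IHn]; first by rewrite big_ord1 coefZ coefX mulr1 add0r invrK.
apply: (mulfI (addr_half_neq0 n.+1)); rewrite -coefZ mpollSS coefB coefZ coefXM /= IHn.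
rewrite nth_default ?size_mpoll ?(leq_trans (size_mpoll _)) //.
rewrite [in RHS]big_ord_recr /=.
by rewrite mulr0 sub0r mulrCA mulrN mulfV ?addr_half_neq0 // mulrN1.
Qed.

Lemma coef_mpoll_neq0 n : (mpoll n)`_n != 0.
Proof.
by rewrite coef_mpoll; apply/prodf_neq0 => k _; rewrite oppr_eq0 invr_neq0 ?addr_half_neq0.
Qed.

Lemma horner_mpollSS n s : (n.+1%:R + 2^-1) * (mpoll n.+2).[s] =
  n.+1%:R * (mpoll n).[s] - s * (mpoll n.+1).[s].
Proof. by rewrite -[LHS]hornerZ mpollSS hornerD hornerN hornerZ hornerM hornerX. Qed.

(** The point masses come in opposite pairs, so parity leaves only the negative nodes to evaluate
    and splits the Gram matrix. *)
Lemma mpollN n s : (mpoll n).[- s] = (-1) ^+ n * (mpoll n).[s].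
Proof.
elim/nat_ind2: n => [||n IHn IHn1].
- by rewrite !hornerC mulr1.
- by rewrite /= !hornerZ !hornerX; ring.
apply: (mulfI (addr_half_neq0 n.+1)); rewrite mulrCA !horner_mpollSS IHn IHn1 !exprS; ring.
Qed.

Lemma mpoll_half n : (mpoll n).[- 2^-1] = 1.
Proof.
elim/nat_ind2: n => [||n IHn IHn1].
- by rewrite hornerC.
- by rewrite /= hornerZ hornerX; field.
apply: (mulfI (addr_half_neq0 n.+1)); rewrite horner_mpollSS IHn IHn1; ring.
Qed.

Lemma mpoll_five_halves n : (mpoll n).[- (2^-1 + 2)] = 4 * n%:R + 1.
Proof.
elim/nat_ind2: n => [||n IHn IHn1].
- by rewrite hornerC mulr0 add0r.
- by rewrite /= hornerZ hornerX; field.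
apply: (mulfI (addr_half_neq0 n.+1)); by rewrite horner_mpollSS IHn IHn1 -!natr1; field.
Qed.
End MeixnerPollaczek.

(** * Hankel and Gram determinants *)

Section Determinants.
Variable S : comNzRingType.

Definition hankel (m : nat -> S) N := \matrix_(i < N, j < N) m (i + j)%N.

(** Linearity is taken along [phi] because [f] will send real polynomials to power series. *)
Lemma hankel_sum (T : comNzRingType) (phi : {rmorphism T -> S})
    (f : {poly T} -> S) N (p q : {poly T}) :
  (forall a u v, f (a *: u + v) = phi a * f u + f v) ->
  (size p <= N)%N -> (size q <= N)%N ->
  f (p * q) = \sum_(i < N) \sum_(j < N) phi p`_i * f 'X^(i + j) * phi q`_j.
Proof.
move=> flin pN qN.
(* With coefficient -1 and both polynomials zero, linearity reads f 0 = - f 0 + f 0. *)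
have f0 : f 0 = 0.
  have := flin (-1) 0 0; rewrite scaler0 addr0 rmorphN1 mulN1r addNr => ->//.
have fsum (a : nat -> T) (u : nat -> {poly T}) :
    f (\sum_(i < N) a i *: u i) = \sum_(i < N) phi (a i) * f (u i).
  apply: (big_ind2 (fun x y => f x = y)) => // [x1 x2 y1 y2 <- <-|i _].
    by rewrite -[x1]scale1r flin rmorph1 mul1r scale1r.
  by rewrite -[_ *: _]addr0 flin f0 addr0.
have expand (r : {poly T}) : (size r <= N)%N -> r = \sum_(i < N) r`_i *: 'X^i.
  move=> rN; rewrite -poly_def; apply/polyP => i; rewrite coef_poly.
  by case: ltnP => // ?; rewrite nth_default // (leq_trans rN).
rewrite {1}(expand p pN) mulr_suml.
under eq_bigr do rewrite -scalerAl.
rewrite (fsum (fun i => p`_i) (fun i => 'X^i * q)); apply: eq_bigr => i _.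
rewrite {1}(expand q qN) mulr_sumr.
under eq_bigr do rewrite -scalerAr -exprD.
rewrite (fsum (fun j => q`_j) (fun j => 'X^(i + j))) mulr_sumr; apply: eq_bigr => j _.
by rewrite [phi q`_j * _]mulrC mulrA.
Qed.

(** The Gram matrix is P H P^T, where row i of P lists the coefficients of [e i]; the size bound
    makes P lower triangular. *)
Lemma hankel_gram (T : comNzRingType) (phi : {rmorphism T -> S}) (f : {poly T} -> S)
    (e : nat -> {poly T}) N :
  (forall a u v, f (a *: u + v) = phi a * f u + f v) ->
  (forall i, size (e i) <= i.+1)%N ->
  \det (\matrix_(i < N, j < N) f (e i * e j)) =
  (\prod_(i < N) phi (e i)`_i) ^+ 2 * \det (hankel (fun m => f 'X^m) N).
Proof.
move=> flin size_e.
pose P : 'M[S]_N := \matrix_(i, k) phi (e i)`_k.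
have -> : \matrix_(i < N, j < N) f (e i * e j) = P *m hankel (fun m => f 'X^m) N *m P^T.
  apply/matrixP => i j; rewrite !mxE.
  rewrite (hankel_sum (N := N) flin) ?(leq_trans (size_e _)) //.
  rewrite exchange_big; apply: eq_bigr => k _; rewrite !mxE mulr_suml.
  by apply: eq_bigr => l _; rewrite !mxE.
rewrite !det_mulmx det_tr mulrAC -expr2; congr (_ ^+ 2 * _).
rewrite det_trig; first by apply: eq_bigr => i _; rewrite mxE.
apply/is_trig_mxP => i j ij; rewrite mxE nth_default ?rmorph0 //.
exact: leq_trans (size_e _) ij.
Qed.

(** Sylvester's identity: the same two block matrices, multiplied in either order, give block
    triangular products whose determinants are the two sides. *)
Lemma det_add1_mul m n (A : 'M[S]_(m, n)) (B : 'M[S]_(n, m)) :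
  \det (1%:M + A *m B) = \det (1%:M + B *m A).
Proof.
have E1 : block_mx 1%:M (- A) B 1%:M *m block_mx 1%:M A 0 1%:M =
  block_mx 1%:M 0 B (1%:M + B *m A).
  rewrite mulmx_block !mulmx1 !mulmx0 !mul1mx !addr0 ?mulmx1.
  by congr block_mx; rewrite ?subrr // addrC.
have E2 : block_mx 1%:M A 0 1%:M *m block_mx 1%:M (- A) B 1%:M =
  block_mx (1%:M + A *m B) 0 B 1%:M.
  rewrite mulmx_block !mulmx1 !mul0mx !mul1mx !add0r.
  by congr block_mx; rewrite addrC subrr.
have := congr1 determinant E1; have := congr1 determinant E2.
by rewrite !det_mulmx !det_lblock !det_ublock !det1 !mul1r !mulr1 => -> ->.
Qed.

Lemma det_mx2 (A : 'M[S]_2) : \det A = A 0 0 * A 1 1 - A 0 1 * A 1 0.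
Proof.
have l0 : lift (0 : 'I_2) 0 = 1 by apply/val_inj.
have l1 : lift (1 : 'I_2) 0 = 0 by apply/val_inj.
rewrite (expand_det_row _ 0) !big_ord_recl big_ord0 addr0 /cofactor !det_mx11 !mxE /=.
by rewrite !l0 l1 addn0 expr0 expr1; ring.
Qed.
End Determinants.

(** * Derivatives of (2 cosh)^(-1/2) *)

Section Moments.
Variable R : realType.

Local Notation ch := (fun x : R => expR x + expR (- x)).
Local Notation sh := (fun x : R => expR x - expR (- x)).
Local Notation g := (fun x : R => (expR x + expR (- x)) `^ (- 2^-1)).

Lemma ch_gt0 x : 0 < ch x.
Proof. by rewrite addr_gt0 ?expR_gt0. Qed.

Lemma is_derive_expRN (x : R) : is_derive x 1 (fun y => expR (- y)) (- expR (- x)).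
Proof.
have := is_derive1_comp (is_derive_expR (- x)) (is_deriveNid x 1).
by rewrite mulrN1.
Qed.

Lemma is_derive_ch (x : R) : is_derive x 1 ch (sh x).
Proof. exact: (is_deriveD (is_derive_expR x) (is_derive_expRN x)). Qed.

Lemma is_derive_sh (x : R) : is_derive x 1 sh (ch x).
Proof.
have := is_deriveB (is_derive_expR x) (is_derive_expRN x).
by rewrite opprK.
Qed.

Lemma is_derive_inv (f : R -> R) x df : f x != 0 ->
  is_derive x 1 f df -> is_derive x 1 (fun y => (f y)^-1) (- (f x) ^- 2 * df).
Proof.
move=> fx0 dfx; apply: DeriveDef; first exact: derivableV.
by rewrite deriveV // derive_val.
Qed.

Lemma is_derive_tanh (x : R) :
  is_derive x 1 (fun y => sh y / ch y) (1 - (sh x / ch x) ^+ 2).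
Proof.
have c0 : ch x != 0 by rewrite gt_eqF ?ch_gt0.
have := is_deriveM (is_derive_sh x) (@is_derive_inv ch x _ c0 (is_derive_ch x)).
congr is_derive; rewrite /GRing.scale /=; field.
exact: c0.
Qed.

Lemma is_derive_powR_ch (x : R) :
  is_derive x 1 g (- 2^-1 * (sh x / ch x) * g x).
Proof.
have c0 := ch_gt0 x.
have := @is_derive1_comp _ (fun y : R => y `^ (- 2^-1)) ch _ _ _
  (is_derive1_powR (- 2^-1) c0) (is_derive_ch x).
congr is_derive.
rewrite powRB; last by apply/implyP => _; rewrite gt_eqF.
by rewrite powRr1 ?ltW //; ring.
Qed.

Lemma derive1n_powR_ch m : derive1n m g =
  fun x => (iter m (@jacobi_op R) 1).[sh x / ch x] * g x.
Proof.
elim: m => [|m IHm].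
  by rewrite derive1n0; apply/funext => x; rewrite hornerC mul1r.
rewrite derive1nS IHm; apply/funext => x; rewrite derive1E.
set Q := iter m _ _.
have dQ := @is_derive1_comp _ (horner Q) (fun y => sh y / ch y) _ _ _
  (is_derive_poly Q _) (is_derive_tanh x).
have dm := is_deriveM dQ (is_derive_powR_ch x).
transitivity ('D_1 ((horner Q \o (fun y => sh y / ch y)) * g) x) => //.
rewrite derive_val iterS -/Q /jacobi_op hornerD hornerN hornerZ !hornerM hornerX.
rewrite !hornerE /GRing.scale /=.
ring.
Qed.

(** At x = 0 the tangent T is 0 and 2 cosh is 2, so only the constant coefficient of Q_m survives,
    times 2^(-1/2). *)
Lemma c0E m : c0 R m =
  if odd m then 0 else (-1) ^+ m./2 * ((iter m (@jacobi_op R) 1)`_0 / Num.sqrt 2).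
Proof.
rewrite /c0; case: ifP => // _; congr (_ * _).
rewrite derive1n_powR_ch /= oppr0 expR0 subrr mul0r horner_coef0; congr (_ * _).
by rewrite powRN powR12_sqrt.
Qed.
End Moments.

(** * Power series modulo a power of q *)

Section PowerSeries.
Variable R : fieldType.
Implicit Types f g : fps R.

Lemma fcoefD f g k : fcoef (f + g) k = fcoef f k + fcoef g k.
Proof. by []. Qed.

Lemma fcoefN f k : fcoef (- f) k = - fcoef f k.
Proof. by []. Qed.

Lemma fcoefM f g k :
  fcoef (f * g) k = \sum_(i < k.+1) fcoef f i * fcoef g (k - i)%N.
Proof. by []. Qed.

Lemma fcoef1 k : fcoef (1 : fps R) k = (k == 0%N)%:R.
Proof. by rewrite /=; case: eqP. Qed.

Lemma fpsC_zmod_morphism : zmod_morphism (@fpsC R).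
Proof. by move=> a b; apply: fpsP => k /=; case: eqP; rewrite ?subr0. Qed.

Lemma fcoefCM a f k : fcoef (fpsC a * f) k = a * fcoef f k.
Proof.
rewrite fcoefM big_ord_recl subn0 big1 ?addr0 // => i _; exact: mul0r.
Qed.

Lemma fpsC_monoid_morphism : monoid_morphism (@fpsC R).
Proof.
split=> // a b; apply: fpsP => k; rewrite fcoefCM /=.
by case: eqP; rewrite ?mulr0.
Qed.

HB.instance Definition _ :=
  GRing.isZmodMorphism.Build R (fps R) (@fpsC R) fpsC_zmod_morphism.
HB.instance Definition _ :=
  GRing.isMonoidMorphism.Build R (fps R) (@fpsC R) fpsC_monoid_morphism.

Lemma fpsCM a b : fpsC (a * b) = fpsC a * fpsC b :> fps R.
Proof. exact: rmorphM. Qed.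

Lemma fps_unitE f : (f \is a GRing.unit) = (fcoef f 0 != 0).
Proof. by []. Qed.

Lemma fpsC_unit a : ((fpsC a : fps R) \is a GRing.unit) = (a != 0).
Proof. by []. Qed.

Lemma fcoefXM f k :
  fcoef (fpsX R * f) k = if k is j.+1 then fcoef f j else 0.
Proof.
rewrite fcoefM big_ord_recl mul0r add0r; case: k => [|k]; first by rewrite big_ord0.
rewrite big_ord_recl big1 ?addr0 => [|i _]; last exact: mul0r.
by rewrite mul1r subSS subn0.
Qed.

Lemma fcoefXnM f n k :
  fcoef (fpsX R ^+ n * f) k = if (k < n)%N then 0 else fcoef f (k - n)%N.
Proof.
elim: n k => [|n IHn] k; first by rewrite expr0 mul1r subn0.
by rewrite exprS -mulrA fcoefXM; case: k => // k; rewrite IHn subSS.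
Qed.

Variable m : nat.

Definition eqX f g := forall k, (k < m)%N -> fcoef f k = fcoef g k.

Lemma eqX_refl f : eqX f f.
Proof. by []. Qed.

Lemma eqX_sym f g : eqX f g -> eqX g f.
Proof. by move=> fg k km; rewrite fg. Qed.

Lemma eqX_trans f g h : eqX f g -> eqX g h -> eqX f h.
Proof. by move=> fg gh k km; rewrite fg ?gh. Qed.

Lemma eqXD f1 f2 g1 g2 : eqX f1 g1 -> eqX f2 g2 -> eqX (f1 + f2) (g1 + g2).
Proof. by move=> fg1 fg2 k km; rewrite !fcoefD fg1 ?fg2. Qed.

Lemma eqXM f1 f2 g1 g2 : eqX f1 g1 -> eqX f2 g2 -> eqX (f1 * f2) (g1 * g2).
Proof.
move=> fg1 fg2 k km; rewrite !fcoefM; apply: eq_bigr => i _.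
by rewrite fg1 ?fg2 // (leq_ltn_trans _ km) ?leq_subr ?leq_ord.
Qed.

Lemma eqXV f g : f \is a GRing.unit -> g \is a GRing.unit ->
  eqX f g -> eqX f^-1 g^-1.
Proof.
move=> uf ug fg.
(* The comparison becomes f^-1 g g^-1 against f^-1 f g^-1. *)
rewrite -[f^-1]mulr1 -[X in eqX _ X]mul1r -{1}(mulrV ug) -(mulVr uf) mulrA.
by apply: eqXM => //; apply: eqXM => //; exact: eqX_sym.
Qed.

Lemma eqX_det N (A B : 'M[fps R]_N) :
  (forall i j, eqX (A i j) (B i j)) -> eqX (\det A) (\det B).
Proof.
move=> AB; apply: (big_ind2 eqX) => // [f1 f2 g1 g2|s _]; first exact: eqXD.
apply: eqXM => //; apply: (big_ind2 eqX) => // f1 f2 g1 g2; exact: eqXM.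
Qed.
End PowerSeries.

(** The series L = q^s/(1 - q^s) satisfies L = q^s (1 + L), a recursion on coefficients in steps of
    [s]. *)
Lemma fcoef_lambert (R : realType) s k : (0 < s)%N -> fcoef (lambert R s) k =
  if (k < s)%N then 0 else (k == s)%:R + fcoef (lambert R s) (k - s)%N.
Proof.
move=> s0; have u : 1 - fpsX R ^+ s \is a GRing.unit.
  by rewrite fps_unitE fcoefD fcoefN -[fpsX R ^+ s]mulr1 fcoefXnM s0 subr0 oner_neq0.
have E : lambert R s = fpsX R ^+ s * (1 + lambert R s).
  apply: (mulIr u); rewrite /lambert divrK // -mulrA mulrDl mul1r divrK //.
  by rewrite subrK mulr1.
rewrite {1}E fcoefXnM; case: ltnP => // sk.
by rewrite fcoefD fcoef1 subn_eq0 eqn_leq sk andbT.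
Qed.

(** * The moment functional modulo q^4 *)

Section HankelDeterminant.
Variable R : realType.
Local Notation w0 := (lambert R 1).
Local Notation w1 := (lambert R 3).
Local Notation "f =4 g" := (eqX 4 f g) (at level 70).

Lemma fcoef_w0 k : fcoef w0 k = (k != 0)%:R.
Proof.
elim: k => [|k IHk]; rewrite fcoef_lambert // subSS subn0 IHk.
by case: k {IHk} => [|k]; rewrite ?addr0 ?add0r.
Qed.

Lemma fcoef_lambert_lt s k : (k < s)%N -> fcoef (lambert R s) k = 0.
Proof. by move=> ks; rewrite fcoef_lambert ?ks // (leq_ltn_trans _ ks). Qed.

Lemma fcoef_w1 k : (k < 4)%N -> fcoef w1 k = (k == 3)%:R.
Proof.
rewrite ltnS leq_eqVlt => /predU1P [->|k3]; last by rewrite fcoef_lambert_lt ?ltn_eqF.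
by rewrite fcoef_lambert // subnn fcoef_lambert_lt // addr0.
Qed.

(** The factors start at q and q^3. This removes the cross terms of the 2 x 2 determinants below. *)
Lemma w0w1_eqX : w0 * w1 =4 0.
Proof.
move=> k k4; rewrite fcoefM big1 => [|i _]; first by case: k k4.
rewrite fcoef_w0 fcoef_w1 ?(leq_ltn_trans (leq_subr _ _)) //.
case: (eqVneq (i : nat) 0) => [|i0]; first by rewrite mul0r.
by rewrite ltn_eqF ?mulr0 //; move: i0 (ltn_ord i) k4; lia.
Qed.

(** The partial sums are constant from [N] on, which turns the limit into a finite sum. *)
Lemma fcoef_fps_sum (G : nat -> fps R) k N :
  (forall l, (N <= l)%N -> fcoef (G l) k = 0) ->
  fcoef (fps_sum G) k = \sum_(l < N) fcoef (G l) k.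
Proof.
move=> G0; rewrite /fps_sum /=; apply/cvg_lim => //.
apply: cvg_near_cst; exists N => // n /= Nn; apply/eqP.
rewrite /series /= (big_cat_nat (leq0n N) Nn) /=.
rewrite [X in _ + X]big_nat_cond [X in _ + X]big1 ?addr0 ?big_mkord //.
by move=> l; rewrite andbT => /andP[/G0].
Qed.

(* The moment functional of the perturbed measure in the variable -i y,
   modulo q^4. *)
Definition moment_functional (p : {poly R}) : fps R :=
  fpsC ((jacobi_eval p)`_0 / Num.sqrt 2)
  + fpsC (p.[- 2^-1] + p.[2^-1]) * w0
  + fpsC (alpha R 1 * (p.[- (2^-1 + 2)] + p.[2^-1 + 2])) * w1.

Lemma moment_functional_lin a p q : moment_functional (a *: p + q) =
  fpsC a * moment_functional p + moment_functional q.
Proof.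
rewrite /moment_functional linearP coefD coefZ !hornerD !hornerZ.
by rewrite !(rmorphD, rmorphM) /=; ring.
Qed.

Lemma coef_jacobi_op_odd m i : odd (m + i) ->
  (iter m (@jacobi_op R) 1)`_i = 0.
Proof.
elim: m i => [|m IHm] i; first by rewrite coef1; case: i.
rewrite iterS coef_jacobi_op coefXM => mi.
rewrite IHm ?addnS // mul0rn sub0r; case: i mi => [|i] mi; first by rewrite mulr0 oppr0.
by rewrite IHm ?mulr0 ?oppr0 //; move: mi; rewrite addSn addnS /= negbK.
Qed.

Lemma hornerXnN m (s : R) : 'X^m.[- s] = (-1) ^+ odd m * 'X^m.[s].
Proof. by rewrite !hornerXn signr_odd -exprNn. Qed.

Lemma moment_functional_odd m : odd m -> moment_functional 'X^m = 0.
Proof.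
move=> om; rewrite /moment_functional jacobi_evalXn coef_jacobi_op_odd ?addn0 // mul0r.
rewrite !hornerXnN om expr1 !mulN1r !hornerXn !addNr.
by rewrite mulr0 !rmorph0 !mul0r !addr0.
Qed.

(** Replacing y by s = -i y multiplies an even moment by (-1)^(m/2); odd moments vanish for both
    variables. *)
Lemma c_eqX m : c R m =4 fpsC ((-1) ^+ m./2) * moment_functional 'X^m.
Proof.
rewrite /c; case: ifPn => om; first by rewrite moment_functional_odd // mulr0.
rewrite c0E (negPf om) /moment_functional jacobi_evalXn.
rewrite !hornerXnN (negPf om) expr0 !mul1r !hornerXn.
move=> k k4; rewrite fcoefD !fcoefCM !fcoefD [fcoef (fpsC _) k]/= [fcoef (fpsC (_ / _)) k]/=.
(* The terms with l >= 2 start at q^5 or later. *)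
rewrite (@fcoef_fps_sum _ _ 2); last first.
  by move=> l l2; rewrite fcoefCM fcoef_lambert_lt ?mulr0 //; lia.
rewrite !big_ord_recl big_ord0 !fcoefCM /= alpha0 !mulr0 !addr0 mul1r mulr1.
set a := 2^-1 ^+ m; set b := (_ + 2) ^+ m.
rewrite [bump 0 0]/=.
by case: (k == 0%N); ring.
Qed.

Definition parity_sum b N (x : nat -> R) : R := \sum_(i < N | odd i == b) x i.

(** Each summand is a mass times the squared value of e_i at its node, divided by the squared norm
    of e_i; the 2 counts the two opposite nodes. *)
Definition hankel_factor b N : fps R :=
  1 + fpsC (2 * parity_sum b N (fun i => Num.sqrt 2 * alpha R i)) * w0
    + fpsC (2 * alpha R 1 * parity_sum b N
        (fun i => Num.sqrt 2 * alpha R i * (4 * i%:R + 1) ^+ 2)) * w1.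

(** Contributions of opposite nodes differ by the sign (-1)^(i + j): they double for equal parities
    and cancel otherwise. *)
Lemma moment_functional_gram i j : moment_functional (mpoll R i * mpoll R j) =
  fpsC ((i == j)%:R * (alpha R i * Num.sqrt 2)^-1)
  + fpsC ((odd i == odd j)%:R * 2) * w0
  + fpsC ((odd i == odd j)%:R * (2 * alpha R 1 * (4 * i%:R + 1) * (4 * j%:R + 1))) * w1.
Proof.
rewrite /moment_functional jacobi_eval_orth jacobi_eval_mpoll coefXn !hornerM.
have E s : (mpoll R i).[s] = (-1) ^+ i * (mpoll R i).[- s] by rewrite -mpollN opprK.
have E' s : (mpoll R j).[s] = (-1) ^+ j * (mpoll R j).[- s] by rewrite -mpollN opprK.
rewrite (E 2^-1) (E' 2^-1) (E (2^-1 + 2)) (E' (2^-1 + 2)).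
rewrite !mpoll_half !mpoll_five_halves.
congr (fpsC _ + fpsC _ * _ + fpsC _ * _).
- by rewrite !invfM; ring.
- by rewrite -(signr_odd _ i) -(signr_odd _ j); case: (odd i); case: (odd j) => /=; ring.
- by rewrite -(signr_odd _ i) -(signr_odd _ j); case: (odd i); case: (odd j) => /=; ring.
Qed.

(** Row and column signs absorb the sign of each moment, since entries with i + j odd vanish; the
    two signs of index i multiply to (-1)^i. *)
Lemma det_hankel_twist N :
  \det (hankel (c R) N) =4
  fpsC (\prod_(i < N) (-1) ^+ i) * \det (hankel (fun m => moment_functional 'X^m) N).
Proof.
pose d1 : 'rV[fps R]_N := \row_i fpsC ((-1) ^+ (i + i./2)).
pose d2 : 'rV[fps R]_N := \row_i fpsC ((-1) ^+ i./2).
pose H := hankel (fun m => moment_functional 'X^m) N.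
(* For i + j even, (-1)^((i + j)/2) = (-1)^(i + i/2) (-1)^(j/2), with the
   integer parts of i/2 and j/2. *)
apply: (@eqX_trans _ _ _ (\det (diag_mx d1 *m H *m diag_mx d2))).
  apply: eqX_det => i j; rewrite mul_mx_diag mul_diag_mx !mxE.
  apply: eqX_trans (c_eqX _) _ => k k4; congr fcoef.
  case: (boolP (odd (i + j))) => oij; first by rewrite moment_functional_odd // !mulr0 mul0r.
  rewrite mulrAC -rmorphM; congr (fpsC _ * _).
  rewrite -exprD -signr_odd -[RHS]signr_odd; congr (_ ^+ nat_of_bool _).
  rewrite halfD !oddD; move: oij; rewrite oddD.
  by rewrite oddb; case: (odd i); case: (odd j); case: (odd i./2); case: (odd j./2).
rewrite !det_mulmx !det_diag mulrAC rmorph_prod /= -big_split.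
move=> k k4; congr (fcoef (_ * _) k); apply: eq_bigr => i _.
rewrite !mxE /= -rmorphM -exprD -addnA addnn exprD.
by rewrite -[X in _ * X]signr_odd odd_double mulr1.
Qed.
End HankelDeterminant.

(** * Gram determinants as low-rank perturbations of a diagonal matrix, split by parity *)

Section GramDeterminant.
Variable R : realType.
Local Notation w0 := (lambert R 1).
Local Notation w1 := (lambert R 3).
Local Notation F := (hankel_factor R).
Local Notation "f =4 g" := (eqX 4 f g) (at level 70).
Local Notation sq2a i := (alpha R i * Num.sqrt 2).

Lemma sq2a_neq0 i : sq2a i != 0.
Proof. by rewrite mulf_neq0 ?alpha_neq0 // sqrtr_eq0 -ltNge. Qed.

(* The values of [mpoll R i] at -1/2 and at -5/2. *)
Definition node_val (k : 'I_2) i : R := if k == 0 then 1 else 4 * i%:R + 1.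
Definition node_weight (k : 'I_2) : fps R :=
  if k == 0 then fpsC 2 * w0 else fpsC (2 * alpha R 1) * w1.
(** The product of [gram_right b] and [gram_left b] is the perturbation within parity [b], each row
    i divided by the squared norm 1/[sq2a i]. *)
Definition gram_right b N : 'M[fps R]_(N, 2) :=
  \matrix_(i, k) fpsC (sq2a i * (odd i == b)%:R * node_val k i).
Definition gram_left b N : 'M[fps R]_(2, N) :=
  \matrix_(k, i) (node_weight k * fpsC ((odd i == b)%:R * node_val k i)).

Lemma gram_leftE b b' N k l : (gram_left b N *m gram_right b' N) k l =
  node_weight k * fpsC ((b == b')%:R *
    parity_sum b N (fun i => sq2a i * node_val k i * node_val l i)).
Proof.
rewrite !mxE /parity_sum mulr_sumr rmorph_sum mulr_sumr [RHS]big_mkcond.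
apply: eq_bigr => i _; rewrite !mxE -mulrA -rmorphM.
case: (eqVneq b b') => [->|bb'].
  by case: eqP => _; rewrite ?mul1r ?mulr1 ?mul0r ?rmorph0 ?mulr0 //;
    congr (_ * fpsC _); ring.
case: (eqVneq (odd i) b) => [->|]; last by rewrite !mul0r rmorph0 mulr0.
by rewrite (negPf bb') mulr0 !mul0r mulr0.
Qed.

Lemma det_1_gram_eqX b N : \det (1%:M + gram_left b N *m gram_right b N) =4 F b N.
Proof.
have E k l : (1%:M + gram_left b N *m gram_right b N) k l = (k == l)%:R +
    node_weight k * fpsC (parity_sum b N (fun i => sq2a i * node_val k i * node_val l i)).
  by rewrite [LHS]mxE gram_leftE eqxx mul1r mxE.
rewrite det_mx2 !E /node_weight /=.
have -> : (fun i => sq2a i * node_val 0 i * node_val 0 i) = (fun i => Num.sqrt 2 * alpha R i).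
  by apply/funext => i; rewrite /node_val /=; ring.
have -> : (fun i => sq2a i * node_val 1 i * node_val 1 i) =
    (fun i => Num.sqrt 2 * alpha R i * (4 * i%:R + 1) ^+ 2).
  by apply/funext => i; rewrite /node_val /=; ring.
rewrite /hankel_factor; set A := parity_sum b N _; set C := parity_sum b N _.
set B := parity_sum b N _; set B' := parity_sum b N _.
(* [Z] is the coefficient of [w0 * w1] in the 2 x 2 determinant. *)
pose Z : fps R := fpsC (4 * alpha R 1 * (C * A - B' * B)).
apply: (@eqX_trans _ _ _ (F b N + Z * (w0 * w1))).
  move=> k k4; congr fcoef.
  by rewrite /hankel_factor -/A -/B /Z !(rmorphB, rmorphM); ring.
rewrite -[X in _ =4 X]addr0 -(mulr0 Z); apply: eqXD => //; apply: eqXM => //.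
exact: w0w1_eqX.
Qed.

(** After the norms are factored out, [det_add1_mul] trades the N x N determinant for a 4 x 4 one,
    which is block diagonal because different parities do not interact. *)
Lemma det_gram N :
  \det (\matrix_(i < N, j < N) moment_functional (mpoll R i * mpoll R j)) =4
  fpsC (\prod_(i < N) (sq2a i)^-1) * (F false N * F true N).
Proof.
pose d : 'rV[fps R]_N := \row_i fpsC (sq2a i)^-1.
have -> : \matrix_(i < N, j < N) moment_functional (mpoll R i * mpoll R j) =
    diag_mx d *m (1%:M + row_mx (gram_right false N) (gram_right true N)
                         *m col_mx (gram_left false N) (gram_left true N)).
  apply/matrixP => i j; rewrite mul_diag_mx mul_row_col mxE moment_functional_gram.
  rewrite [RHS]mxE [X in _ = _ * X]mxE [X in _ = _ * (_ + X)]mxE.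
  rewrite ![(_ *m _) i j]mxE !big_ord_recl !big_ord0 !mxE /node_weight /node_val /=.
  have ua : fpsC (sq2a i)^-1 * fpsC (sq2a i) = 1.
    by rewrite -rmorphM mulVf ?sq2a_neq0.
  move: (sq2a i) (alpha R 1) (4 * i%:R + 1) (4 * j%:R + 1) ua => a a1 u v ua.
  have -> : (i == j)%:R = fpsC ((i == j)%:R : R) by rewrite rmorph_nat.
  move: ((i == j)%:R : R) => e; rewrite !fpsCM.
  move: (fpsC a^-1) (fpsC a) ua => b c ua.
  by case: (odd i); case: (odd j);
    rewrite /= ?(rmorph0 (@fpsC R)) ?(rmorph1 (@fpsC R)); ring: ua.
rewrite det_mulmx det_diag det_add1_mul mul_col_row.
have off b : gram_left b N *m gram_right (~~ b) N = 0.
  apply/matrixP => k l; rewrite gram_leftE mxE.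
  by case: b; rewrite mul0r rmorph0 mulr0.
rewrite (off false) (off true) scalar_mx_block add_block_mx !addr0 det_ublock.
apply: eqXM; last by apply: eqXM; exact: det_1_gram_eqX.
by rewrite rmorph_prod; under eq_bigr do rewrite mxE.
Qed.

(* The value at q = 0 of the ratio of consecutive Hankel determinants. *)
Definition kappa i : R := (-1) ^+ i * (sq2a i)^-1 * ((mpoll R i)`_i) ^- 2.

Lemma kappa_neq0 i : kappa i != 0.
Proof.
rewrite /kappa !mulf_neq0 ?invr_neq0 ?sq2a_neq0 ?expf_neq0 ?signr_eq0 //.
exact: coef_mpoll_neq0.
Qed.

(** The ratio of consecutive [kappa] is the value of a(i)^2 at q = 0. *)
Lemma kappaS i : kappa i.+1 = (i%:R + 1) * (i%:R + 2^-1) * kappa i.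
Proof.
have h := addr_half_neq0 R i; have a0 := alpha_neq0 R i.
have s0 : Num.sqrt 2 != 0 :> R by rewrite sqrtr_eq0 -ltNge.
have i0 : 0 <= i%:R :> R by [].
have l0 := coef_mpoll_neq0 R i.
rewrite /kappa exprS alphaSE coef_mpoll big_ord_recr -coef_mpoll /=.
by move: ((-1) ^+ i) => e; field; rewrite l0 s0 a0 !gt_eqF //; lra.
Qed.

Lemma det_hankel N : \det (hankel (c R) N) =4
  fpsC (\prod_(i < N) kappa i) * (F false N * F true N).
Proof.
apply: eqX_trans (det_hankel_twist R N) _.
have := det_gram N.
rewrite (hankel_gram N (phi := @fpsC R) (@moment_functional_lin R) (size_mpoll R)).
rewrite -rmorph_prod -rmorphXn => detG.
have pn0 : \prod_(i < N) (mpoll R i)`_i != 0.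
  by apply/prodf_neq0 => i _; exact: coef_mpoll_neq0.
(* Multiplication by [K] cancels the leading coefficients and restores the signs of the twist. *)
pose K := (\prod_(i < N) (-1) ^+ i) * (\prod_(i < N) (mpoll R i)`_i) ^- 2.
have := eqXM (eqX_refl (fpsC K)) detG; rewrite /K.
rewrite !mulrA -!rmorphM; congr (eqX _ (fpsC _ * _) (fpsC _ * _ * _)).
  by rewrite -mulrA mulVf ?mulr1 ?expf_neq0.
rewrite -exprVn -prodfV -prodrXl -!big_split; apply: eq_bigr => i _ /=.
by rewrite /kappa exprVn mulrAC.
Qed.
End GramDeterminant.

(** * The binomial series at 1 *)

Section AlphaSum.
Variable R : realType.
Local Open Scope classical_set_scope.

(** A Wallis-type bound, used to see that alpha_n tends to 0; in the induction the gap between the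
    bounds is explicit and positive. *)
Lemma alpha_sqr_le n : alpha R n ^+ 2 <= (2 * n%:R + 1)^-1.
Proof.
elim: n => [|n IHn]; first by rewrite alpha0 expr1n mulr0 add0r invr1.
have n0 : 0 <= n%:R :> R by [].
rewrite alphaSE exprMn -[n.+1%:R]natr1.
apply: le_trans (ler_wpM2l (sqr_ge0 _) IHn) _.
rewrite -subr_ge0.
have -> : (2 * (n%:R + 1) + 1)^-1 -
   (- (n%:R + 2^-1) / (n%:R + 1)) ^+ 2 * (2 * n%:R + 1)^-1 =
   (4 * (n%:R + 1) ^+ 2 * (2 * n%:R + 3))^-1 :> R.
  by field; rewrite !gt_eqF //; lra.
by rewrite invr_ge0 !mulr_ge0 ?sqr_ge0 //; lra.
Qed.

(* A partial sum of the binomial series of (1 + x)^(-1/2). *)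
Definition alpha_poly n : {poly R} := \poly_(i < n.+1) alpha R i.

(** The function (1 + x)^(-1/2) solves 2 (1 + x) y' + y = 0; truncation leaves an error in the top
    degree only. *)
Lemma alpha_poly_ode n :
  2 *: ((1 + 'X) * (alpha_poly n)^`()) + alpha_poly n =
  ((2 * n%:R + 1) * alpha R n) *: 'X^n.
Proof.
apply/polyP => i.
have X_deriv : ('X * (alpha_poly n)^`())`_i = (alpha_poly n)`_i *+ i.
  by rewrite coefXM coef_deriv; case: i.
rewrite coefD !coefZ [(1 + 'X) * _]mulrDl mul1r coefD X_deriv coef_deriv !coef_poly coefXn.
rewrite ltnS -[_ *+ i.+1]mulr_natl -[_ *+ i]mulr_natl -[i.+1%:R]natr1.
case: (ltngtP i n) => [lt_in|lt_ni|->].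
- by rewrite ltnS (ltnW lt_in) mulr0 alphaS; field.
- have -> : (i < n.+1)%N = false by lia.
  by rewrite !mulr0 !addr0 mulr0.
by rewrite ltnSn mulr1; ring.
Qed.

(** The function h(x) = (1 + x)^(1/2) P(x), with P = [alpha_poly n], runs from 1 at x = 0 to the
    scaled partial sum at x = 1, and the differential equation makes h' a single explicit term. *)
Lemma alpha_sum_bound n :
  `|Num.sqrt 2 * (\sum_(i < n.+1) alpha R i) - 1| <= `|alpha R n|.
Proof.
pose h (x : R) := (1 + x) `^ 2^-1 * (alpha_poly n).[x].
have dh (x : R) : 0 <= x ->
    is_derive x 1 h ((n%:R + 2^-1) * alpha R n * x ^+ n * (1 + x) `^ (- 2^-1)).
  move=> x0; have x1 : 0 < 1 + x by lra.
  have d1 : is_derive x 1 (fun y : R => 1 + y) 1.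
    have := is_deriveD (is_derive_cst (1 : R) x (1 : R)) (is_derive_id x (1 : R)).
    by rewrite add0r.
  have d2 := @is_derive1_comp _ (fun y : R => y `^ 2^-1) _ _ _ _
    (is_derive1_powR 2^-1 x1) d1.
  have := is_deriveM d2 (is_derive_poly (alpha_poly n) x).
  congr is_derive; rewrite /GRing.scale /=.
  have -> : 2^-1 - 1 = - 2^-1 :> R by field.
  have -> : (1 + x) `^ 2^-1 = (1 + x) * (1 + x) `^ (- 2^-1).
    by rewrite -[LHS]mulr_powRB1 ?invr_gt0 ?ltW //; congr (_ * _ `^ _); field.
  move: ((1 + x) `^ (- 2^-1)) => r.
  have ode : 2 * ((1 + x) * (alpha_poly n)^`().[x]) + (alpha_poly n).[x] =
      (2 * n%:R + 1) * alpha R n * x ^+ n.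
    have := congr1 (horner ^~ x) (alpha_poly_ode n).
    by rewrite /= hornerD !hornerZ hornerM hornerD hornerC hornerX hornerXn.
  transitivity (2^-1 * r * (2 * ((1 + x) * (alpha_poly n)^`().[x]) + (alpha_poly n).[x])).
    by field.
  by rewrite ode; move: (alpha R n) => al; field.
have step (e : R) : `|e| = 1 ->
    e * (Num.sqrt 2 * (\sum_(i < n.+1) alpha R i) - 1) <= `|alpha R n|.
  move=> e1.
  (* On [0, 1] the derivative (n + 1) |alpha_n| x^n of [p] dominates |h'|, so p - e h does not
     decrease from 0 to 1; the signs e = 1 and e = -1 give the two bounds. *)
  pose p : {poly R} := `|alpha R n| *: 'X^(n.+1).
  pose f (x : R) : R := p.[x] - e * h x.
  have df (x : R) : 0 <= x -> is_derive x 1 f (p^`().[x] -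
      e * ((n%:R + 2^-1) * alpha R n * x ^+ n * (1 + x) `^ (- 2^-1))).
    by move=> x0; have := is_deriveB (is_derive_poly p x) (is_deriveZ e (dh x x0)).
  have [||c] := MVT_segment ler01 (f := f) (df := fun x => p^`().[x] -
      e * ((n%:R + 2^-1) * alpha R n * x ^+ n * (1 + x) `^ (- 2^-1))).
  - by move=> x; rewrite in_itv /= => /andP[/ltW /df].
  - apply: derivable_within_continuous => y; rewrite in_itv /= => /andP[/df dy _].
    exact: ex_derive.
  rewrite in_itv /= subr0 mulr1 => /andP[c0 _] f10.
  have f1 : f 1 = `|alpha R n| - e * (Num.sqrt 2 * (\sum_(i < n.+1) alpha R i)).
    rewrite /f /h /p hornerZ hornerXn expr1n mulr1 -[1 + 1]/(2 : R) powR12_sqrt //.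
    rewrite /alpha_poly horner_poly; congr (_ - _ * (_ * _)).
    by apply: eq_bigr => i _; rewrite expr1n mulr1.
  have f0 : f 0 = - e.
    rewrite /f /h /p hornerZ hornerXn expr0n mulr0 addr0 powR1 horner_coef0 coef_poly.
    by rewrite alpha0 !mulr1 sub0r.
  suff : 0 <= f 1 - f 0 by rewrite f1 f0; lra.
  have r0 := powR_ge0 (1 + c) (- 2^-1).
  have r1 : (1 + c) `^ (- 2^-1) <= 1.
    by rewrite -[leRHS](powRr0 (1 + c)) ler_powR ?lerDl // oppr_le0 invr_ge0.
  rewrite f10 /p derivZ derivXn hornerZ hornerMn hornerXn subr_ge0.
  have n0 : 0 <= n%:R :> R by [].
  move: (alpha R n) => al.
  apply: le_trans (ler_norm _) _; rewrite !normrM e1 mul1r.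
  rewrite (ger0_norm r0) (ger0_norm (exprn_ge0 n c0)) (@ger0_norm _ (_ + _)); last by lra.
  rewrite -[_ *+ n.+1]mulr_natl -[n.+1%:R]natr1.
  have ac : 0 <= `|al| * c ^+ n by rewrite mulr_ge0 ?exprn_ge0.
  apply: (@le_trans _ _ ((n%:R + 2^-1) * (`|al| * c ^+ n))); last first.
    by rewrite [leRHS]mulrCA /= ler_wpM2r //; lra.
  by rewrite -(mulrA _ `|al|) ler_piMr // mulr_ge0 //; lra.
have sP := step 1 (normr1 R); have sN := step (- 1) (normrN1 R).
by rewrite ler_norml; lra.
Qed.

Definition alpha_sum n : R := \sum_(i < n) alpha R i.

Lemma cvg_alpha_sum : alpha_sum n @[n --> \oo] --> (Num.sqrt 2)^-1.
Proof.
rewrite -cvg_shiftS; apply/cvgrPdist_le => e e0.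
have s0 : 1 <= Num.sqrt 2 :> R by rewrite -{1}(sqrtr1 R) ler_sqrt //; lra.
near=> n.
rewrite distrC -(ler_pM2l (lt_le_trans ltr01 s0)) -{1}(ger0_norm (le_trans ler01 s0)) -normrM.
rewrite mulrBr mulfV ?gt_eqF ?(lt_le_trans ltr01) //.
apply: le_trans (alpha_sum_bound n) _.
apply: (@le_trans _ _ e); last by rewrite ler_peMl // ltW.
(* Comparing squares, alpha_n^2 <= 1/(2n + 1) <= 1/(n + 1) < e^2 for large n. *)
rewrite -(@ler_pXn2r _ 2) ?nnegrE ?(ltW e0) // real_normK ?num_real //.
apply: le_trans (alpha_sqr_le n) _.
have n0 : 0 <= n%:R :> R by [].
apply: (@le_trans _ _ (n.+1%:R^-1)); last first.
  by apply: ltW; near: n; exact: (near_infty_natSinv_lt (PosNum (exprn_gt0 2 e0))).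
by rewrite lef_pV2 ?posrE -?natr1; lra.
Unshelve. all: by end_near. Qed.

(** The ratio alpha_(n+k)/alpha_n is the k-th term of the Gauss series of Y, which makes alpha_n Y
    the tail of the binomial series. *)
Lemma alpha_poch n k : alpha R (n + k) = alpha R n *
  (pochhammer 1 k * pochhammer (n%:R + 2^-1) k /
   (pochhammer (n%:R + 1) k * k`!%:R) * (-1) ^+ k).
Proof.
elim: k => [|k IHk]; first by
  rewrite addn0 /pochhammer !big_ord0 fact0 expr0 mulr1 !mul1r invr1 !mulr1.
rewrite addnS alphaSE IHk /pochhammer !big_ord_recr /= factS exprS natrM natrD -[k.+1%:R]natr1.
have p0 : \prod_(i < k) (n%:R + 1 + i%:R) != 0 :> R.
  apply/prodf_neq0 => i _; by rewrite gt_eqF // ltr_wpDr // ltr_wpDl.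
have f0 : k`!%:R != 0 :> R by rewrite pnatr_eq0 -lt0n fact_gt0.
have n0 : 0 <= n%:R :> R by [].
have k0 : 0 <= k%:R :> R by [].
move: (\prod_(i < k) (n%:R + 1 + i%:R)) (k`!%:R) p0 f0 => p f p0 f0.
by field; rewrite p0 f0 !gt_eqF //; lra.
Qed.

Lemma alpha_hyp2F1 n :
  alpha R n * hyp2F1 1 (n%:R + 2^-1) (n%:R + 1) (-1) = (Num.sqrt 2)^-1 - alpha_sum n.
Proof.
have a0 := alpha_neq0 R n.
suff -> : hyp2F1 1 (n%:R + 2^-1) (n%:R + 1) (-1) =
    (alpha R n)^-1 * ((Num.sqrt 2)^-1 - alpha_sum n) by rewrite mulVKf.
rewrite /hyp2F1; apply/cvg_lim => //.
have -> : series (fun k =>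
    pochhammer 1 k * pochhammer (n%:R + 2^-1) k /
    (pochhammer (n%:R + 1) k * k`!%:R) * (-1) ^+ k : R)
    = (fun N => (alpha R n)^-1 * (alpha_sum (N + n) - alpha_sum n)).
  apply/funext => N; rewrite /series /= /alpha_sum addnC big_split_ord /=.
  rewrite [X in _ * (X - _)]addrC addrK.
  rewrite big_mkord mulr_sumr; apply: eq_bigr => k _.
  by rewrite alpha_poch mulKf.
apply: cvgMr; apply: cvgB; last exact: cvg_cst.
rewrite (cvg_shiftn n alpha_sum); exact: cvg_alpha_sum.
Qed.
End AlphaSum.

(** * The Jacobi coefficients modulo q^4 *)

Section JacobiCoefficients.
Variable R : realType.
Local Notation w0 := (lambert R 1).
Local Notation w1 := (lambert R 3).
Local Notation F := (hankel_factor R).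
Local Notation "f =4 g" := (eqX 4 f g) (at level 70).
Local Notation t n := (2 * Num.sqrt 2 * alpha R n).

(** The case [n = 0] matches D_(-1) = 1 with the empty determinant. *)
Lemma D_pred n : D R (n%:Z - 1) = \det (hankel (c R) n).
Proof. by case: n => [|n]; rewrite ?det_mx00 // intS addrC addKr. Qed.

Lemma asqE n : asq R n%:Z =
  \det (hankel (c R) n) * \det (hankel (c R) n.+2) / \det (hankel (c R) n.+1) ^+ 2.
Proof. by rewrite /asq D_pred addrC -intS. Qed.

Lemma parity_sumS b N (x : nat -> R) :
  parity_sum b N.+1 x = parity_sum b N x + (odd N == b)%:R * x N.
Proof.
rewrite /parity_sum [LHS]big_mkcond [in RHS]big_mkcond big_ord_recr /=; congr (_ + _).
by case: eqP; rewrite ?mul1r ?mul0r.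
Qed.

Lemma parity_sumS_same N (x : nat -> R) :
  parity_sum (odd N) N.+1 x = parity_sum (odd N) N x + x N.
Proof. by rewrite parity_sumS eqxx mul1r. Qed.

Lemma parity_sumS_diff N (x : nat -> R) :
  parity_sum (~~ odd N) N.+1 x = parity_sum (~~ odd N) N x.
Proof. by rewrite parity_sumS; case: (odd N); rewrite mul0r addr0. Qed.

Lemma hankel_factor_stable n : F (~~ odd n) n.+1 = F (~~ odd n) n.
Proof. by rewrite /hankel_factor !parity_sumS_diff. Qed.

(** Modulo q^4 this says f = 1 + a (q + q^2 + q^3) + g q^3, that is 1 + a [w0] + g [w1]. *)
Definition jet (f : fps R) a g :=
  [/\ fcoef f 0 = 1, fcoef f 1 = a, fcoef f 2 = a & fcoef f 3 = a + g].

Lemma hankel_factor_jet b N : jet (F b N)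
  (2 * parity_sum b N (fun i => Num.sqrt 2 * alpha R i))
  (2 * alpha R 1 * parity_sum b N
    (fun i => Num.sqrt 2 * alpha R i * (4 * i%:R + 1) ^+ 2)).
Proof.
rewrite /hankel_factor; set A := parity_sum _ _ _; set C := parity_sum _ _ _.
by split; rewrite !fcoefD !fcoefCM fcoef1 fcoef_w0 fcoef_w1 //= ?mulr0 ?mulr1 ?addr0 ?add0r.
Qed.

Lemma hankel_factor_unit b N : F b N \is a GRing.unit.
Proof. by rewrite fps_unitE; case: (hankel_factor_jet b N) => -> *; exact: oner_neq0. Qed.

(** Enlarging the matrix by index N changes only the factor of the parity of N. Hence one factor of
    each parity cancels in the quotient, and [kappaS] gives the constant. *)
Lemma asq_eqX n : asq R n%:Z =4
  fpsC ((n%:R + 1) * (n%:R + 2^-1)) *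
  (F (odd n) n * F (~~ odd n) n.+2 * (F (odd n) n.+1)^-1 * (F (~~ odd n) n)^-1).
Proof.
have FF N : F false N * F true N = F (odd n) N * F (~~ odd n) N.
  by case: (odd n); rewrite //= mulrC.
have H N : \det (hankel (c R) N) =4
  fpsC (\prod_(i < N) kappa R i) * (F (odd n) N * F (~~ odd n) N).
  by rewrite -FF; exact: det_hankel.
have K0 N : \prod_(i < N) kappa R i != 0.
  by apply/prodf_neq0 => i _; exact: kappa_neq0.
have U N : fpsC (\prod_(i < N) kappa R i) * (F (odd n) N * F (~~ odd n) N)
    \is a GRing.unit.
  by rewrite !unitrM fpsC_unit K0 !hankel_factor_unit.
have UH N : \det (hankel (c R) N) \is a GRing.unit.
  by rewrite fps_unitE H // -fps_unitE.
rewrite asqE.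
have Hsq : \det (hankel (c R) n.+1) ^+ 2 =4
    (fpsC (\prod_(i < n.+1) kappa R i) * (F (odd n) n.+1 * F (~~ odd n) n.+1)) ^+ 2.
  by rewrite !expr2; apply: eqXM.
have := eqXM (eqXM (H n) (H n.+2)) (eqXV (unitrX 2 (UH n.+1)) (unitrX 2 (U n.+1)) Hsq).
congr (eqX _ _ _).
apply: (mulIr (unitrX 2 (U n.+1))); rewrite divrK ?unitrX //.
have E : F (odd n) n.+2 = F (odd n) n.+1.
  by have := hankel_factor_stable n.+1; rewrite /= negbK.
rewrite E hankel_factor_stable !big_ord_recr /= kappaS -/(fpsC _).
have := mulVr (hankel_factor_unit (odd n) n.+1); have := mulVr (hankel_factor_unit (~~ odd n) n).
move: (F (odd n) n.+1)^-1 (F (~~ odd n) n)^-1 => fi gi gig fif.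
rewrite !fpsCM; ring: gig fif.
Qed.

(** The q^3 coefficient of (1 + a1 w)(1 + a2 w)/((1 + a3 w)(1 + a4 w)) for w = q/(1 - q): the
    weights 1, 2, 1 are the q^3 coefficients of w, w^2, w^3. *)
Definition quot3 (a1 a2 a3 a4 : R) :=
  let p1 := a1 + a2 in let p2 := a1 * a2 in
  let s1 := - (a3 + a4) in let s2 := a3 ^+ 2 + a3 * a4 + a4 ^+ 2 in
  let s3 := - (a3 ^+ 3 + a3 ^+ 2 * a4 + a3 * a4 ^+ 2 + a4 ^+ 3) in
  (p1 + s1) + 2 * (p2 + p1 * s1 + s2) + (p2 * s1 + p1 * s2 + s3).

(** The g's first appear at q^3, where they meet only constant coefficients 1 and so enter
    linearly. *)
Lemma fcoef3_quot f1 f2 f3 f4 a1 g1 a2 g2 a3 g3 a4 g4 :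
  jet f1 a1 g1 -> jet f2 a2 g2 -> jet f3 a3 g3 -> jet f4 a4 g4 ->
  fcoef (f1 * f2 * f3^-1 * f4^-1) 3 = quot3 a1 a2 a3 a4 + (g1 + g2 - g3 - g4).
Proof.
have inv f a g : jet f a g -> [/\ fcoef f^-1 0 = 1, fcoef f^-1 1 = - a,
    fcoef f^-1 2 = a ^+ 2 - a & fcoef f^-1 3 = - a ^+ 3 + 2 * a ^+ 2 - a - g].
  case=> e0 e1 e2 e3.
  have u : f \is a GRing.unit by rewrite fps_unitE e0 oner_neq0.
  have E k : fcoef (f^-1 * f) k = (k == 0%N)%:R by rewrite mulVr // fcoef1.
  have := E 3 : _ = 0; have := E 2 : _ = 0; have := E 1 : _ = 0.
  have := E 0 : _ = 1.
  rewrite !fcoefM !big_ord_recl !big_ord0 /bump /= e0 e1 e2 e3.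
  move: (fcoef f^-1 0) (fcoef f^-1 1) (fcoef f^-1 2) (fcoef f^-1 3) => h0 h1 h2 h3 H0 H1 H2 H3.
  have E0 : h0 = 1 by rewrite -H0 mulr1 addr0.
  have E1 : h1 = - a.
    by transitivity (h0 * a + (h1 * 1 + 0) - h0 * a); [ring | rewrite H1 E0; ring].
  have E2 : h2 = a ^+ 2 - a.
    transitivity (h0 * a + (h1 * a + (h2 * 1 + 0)) - h0 * a - h1 * a); first by ring.
    by rewrite H2 E0 E1; ring.
  have E3 : h3 = - a ^+ 3 + 2 * a ^+ 2 - a - g.
    transitivity (h0 * (a + g) + (h1 * a + (h2 * a + (h3 * 1 + 0)))
      - h0 * (a + g) - h1 * a - h2 * a); first by ring.
    by rewrite H3 E0 E1 E2; ring.
  by rewrite E0 E1 E2 E3.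
move=> [a10 a11 a12 a13] [a20 a21 a22 a23] /inv [a30 a31 a32 a33] /inv [a40 a41 a42 a43].
rewrite /quot3.
move: (f3^-1) (f4^-1) a30 a31 a32 a33 a40 a41 a42 a43.
move=> h3 h4 a30 a31 a32 a33 a40 a41 a42 a43.
have M (f g : fps R) : [/\ fcoef (f * g) 0 = fcoef f 0 * fcoef g 0,
   fcoef (f * g) 1 = fcoef f 0 * fcoef g 1 + fcoef f 1 * fcoef g 0,
   fcoef (f * g) 2 = fcoef f 0 * fcoef g 2 + fcoef f 1 * fcoef g 1 + fcoef f 2 * fcoef g 0
 & fcoef (f * g) 3 = fcoef f 0 * fcoef g 3 + fcoef f 1 * fcoef g 2
     + fcoef f 2 * fcoef g 1 + fcoef f 3 * fcoef g 0].
  by split; rewrite fcoefM !big_ord_recl big_ord0 addr0 ?addrA.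
have [b0 b1 b2 b3] := M f1 f2.
have [c0 c1 c2 c3] := M (f1 * f2) h3.
have [_ _ _ ->] := M (f1 * f2 * h3) h4.
rewrite c0 c1 c2 c3 b0 b1 b2 b3.
rewrite a10 a11 a12 a13 a20 a21 a22 a23 a30 a31 a32 a33 a40 a41 a42 a43.
ring.
Qed.

Local Notation A b n := (parity_sum b n (fun i => Num.sqrt 2 * alpha R i)).

Lemma parity_sum_add n : A (odd n) n + A (~~ odd n) n = Num.sqrt 2 * alpha_sum R n.
Proof.
have -> : A (odd n) n + A (~~ odd n) n = A true n + A false n.
  by case: (odd n) => //=; rewrite addrC.
rewrite /alpha_sum; elim: n => [|n IHn].
  by rewrite /parity_sum !big_ord0 mulr0 addr0.
rewrite !parity_sumS big_ord_recr mulrDr -IHn /=.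
by case: (odd n); rewrite /= ?mul1r ?mul0r; ring.
Qed.

(** Appending index n swaps the two roles, so the difference d satisfies d(n+1) = - d(n) - sqrt 2
    alpha_n, which n t(n) solves by the recurrence of alpha. *)
Lemma parity_sum_sub n : A (odd n) n - A (~~ odd n) n = n%:R * t n.
Proof.
elim: n => [|n IHn]; first by rewrite /parity_sum !big_ord0 subr0 mul0r.
rewrite /= negbK !parity_sumS alphaSE -[n.+1%:R]natr1.
have n1 : n%:R + 1 != 0 :> R by rewrite natr1 pnatr_eq0.
rewrite eqxx (_ : odd n == ~~ odd n = false); last by case: (odd n).
transitivity (- (A (odd n) n - A (~~ odd n) n) - Num.sqrt 2 * alpha R n).
  by rewrite mul0r mul1r; ring.
by rewrite IHn; field.
Qed.

Lemma fcoef3_asq n : fcoef (asq R n%:Z) 3 = (n%:R + 1) * (n%:R + 2^-1) *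
  (quot3 (2 * A (odd n) n) (2 * A (~~ odd n) n + t n.+1)
         (2 * A (odd n) n + t n) (2 * A (~~ odd n) n)
   + 2^-1 * (t n * (4 * n%:R + 1) ^+ 2 - t n.+1 * (4 * n.+1%:R + 1) ^+ 2)).
Proof.
rewrite asq_eqX // fcoefCM; congr (_ * _).
rewrite (fcoef3_quot (hankel_factor_jet _ _) (hankel_factor_jet _ _)
  (hankel_factor_jet _ _) (hankel_factor_jet _ _)).
rewrite parity_sumS_same parity_sumS_same -[~~ odd n]/(odd n.+1).
rewrite !parity_sumS_same /= !parity_sumS_diff.
have -> : alpha R 1 = - 2^-1 by rewrite alphaSE alpha0; field.
move: (alpha R n) (alpha R n.+1) => al al1.
congr (_ + _); last by field.
by congr quot3; ring.
Qed.

Lemma parity_sum_hyp2F1 n : 2 * A (odd n) n + 2 * A (~~ odd n) n =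
  2 - t n * hyp2F1 1 (n%:R + 2^-1) (n%:R + 1) (-1).
Proof.
have s0 : Num.sqrt 2 != 0 :> R by rewrite sqrtr_eq0 -ltNge.
rewrite -mulrDr parity_sum_add -[X in 2 - X]mulrA alpha_hyp2F1.
by move: (alpha_sum R n) => S; field.
Qed.

Lemma subr_half_neq0 n : n%:R - 2^-1 != 0 :> R.
Proof.
case: n => [|n]; first by rewrite sub0r oppr_eq0 invr_neq0.
have -> : n.+1%:R - 2^-1 = n%:R + 2^-1 :> R by rewrite -natr1; field.
exact: addr_half_neq0.
Qed.

(** This is [fcoef3_asq] at n - 1, rewritten with the sums up to n and t(n-1) = - x/(x - 1/2) t(n).
    For n = 0 the factor [x] agrees with a(-1)^2 = 0. *)
Lemma fcoef3_asq_pred n (x : R := n%:R) : fcoef (asq R (n%:Z - 1)) 3 =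
  x * (x - 2^-1) *
  (quot3 (2 * A (~~ odd n) n + x / (x - 2^-1) * t n) (2 * A (odd n) n + t n)
         (2 * A (~~ odd n) n) (2 * A (odd n) n)
   - 2^-1 * (x / (x - 2^-1) * t n * (4 * x - 3) ^+ 2 + t n * (4 * x + 1) ^+ 2)).
Proof.
have := subr_half_neq0 n.
rewrite /x; case: n {x} => [|n] h; first by rewrite !mul0r.
have h2 := addr_half_neq0 R n; have n0 : 0 <= n%:R :> R by [].
rewrite intS addrC addKr fcoef3_asq /= negbK parity_sumS_same parity_sumS_diff.
have E : n.+1%:R - 2^-1 = n%:R + 2^-1 :> R by rewrite -[n.+1%:R]natr1; field.
have -> : n.+1%:R / (n.+1%:R - 2^-1) * t n.+1 = - t n.
  by rewrite E alphaSE -[n.+1%:R]natr1; field; rewrite !gt_eqF //; lra.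
rewrite E; congr (_ * _ * _); first by rewrite natr1.
move: (alpha R n) (alpha R n.+1) => al al1.
congr (_ + _); last by rewrite -[n.+1%:R]natr1; field.
by congr quot3; ring.
Qed.

End JacobiCoefficients.

Theorem theorem7p8 (R : realType) (n : nat) :
  let Y : R := hyp2F1 1 (n%:R + 2^-1) (n%:R + 1) (-1) in
  let t : R := 2 * Num.sqrt 2 * alpha R n in
  let x : R := n%:R in
  fcoef (minus_i_d R n) 3 =
    - (1 / 16) * (16 * x ^+ 2 + 8 * x + 3) * t ^+ 3 * Y ^+ 2
    + (1 / 4) * (4 * x ^+ 2 + 11 * x + 3) * t ^+ 3 * Y
    - (4 * x ^+ 4 + 4 * x ^+ 3 + 23 * x ^+ 2 / 4 + 7 * x / 2 + 3 / 4) * t ^+ 3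
    + (32 * x ^+ 4 + 32 * x ^+ 3 + 48 * x ^+ 2 + 20 * x + 27 / 8) * t.
Proof.
move=> Y t x; rewrite /minus_i_d !fcoefD fcoefN add0r fcoef3_asq.
have tS k : 2 * Num.sqrt 2 * alpha R k.+1 =
    - (k%:R + 2^-1) / (k%:R + 1) * (2 * Num.sqrt 2 * alpha R k).
  by rewrite alphaSE mulrCA.
have addA := parity_sum_hyp2F1 R n; have subA := parity_sum_sub R n.
rewrite -/Y -/t in addA subA.
set a := parity_sum (odd n) n _ in addA subA *.
set b := parity_sum (~~ odd n) n _ in addA subA *.
(* Half-sum and half-difference recover both parity sums from Y and t. *)
have aE : 2 * a = (2 - t * Y) / 2 + x * t.
  have -> : 2 * a = (2 * a + 2 * b) / 2 + (a - b) by field.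
  by rewrite addA subA.
have bE : 2 * b = (2 - t * Y) / 2 - x * t.
  have -> : 2 * b = (2 * a + 2 * b) / 2 - (a - b) by field.
  by rewrite addA subA.
rewrite aE bE tS -[n.+1%:R]natr1 -/t -/x.
have x0 : 0 <= x by [].
rewrite fcoef3_asq_pred -/a -/b aE bE -/t -/x /quot3.
move: (subr_half_neq0 R n); rewrite -/x => xh.
(* The condition x != 1/2 in the denominator-free form that [field] asks for. *)
have xh2 : x * 2 - 1 != 0.
  have -> : x * 2 - 1 = 2 * (x - 2^-1) by field.
  by rewrite mulf_neq0.
by field; rewrite xh2 natr1 pnatr_eq0.
Qed.
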